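(* Let $\tilde A$ be an $n\times n$ real isotropic matrix all of whose eigenvalues are equal to $1$ in absolute value, and let $\tilde A=QUQ^{-1}$, where $U$ is an orthogonal real $n\times n$ matrix and $Q$ is a symmetric positive definite real $n\times n$ matrix. Then $$\tilde A^{T}Q^{-2}\tilde A=\left(\tilde A^{T}\right)^{-1}Q^{-2}\tilde A^{-1}=Q^{-2}$$ and $$\tilde A Q^{2}\tilde A^{T}=\tilde A^{-1}Q^{2}\left(\tilde A^{T}\right)^{-1}=Q^{2}.$$
   Context: A real square matrix is called isotropic if it is diagonalizable over $\mathbb{C}$ and all its (complex) eigenvalues are equal in absolute value. For such a matrix with all eigenvalues of absolute value $1$, a decomposition $\tilde A=QUQ^{-1}$ with $U$ real orthogonal and $Q$ real symmetric positive definite exists. *)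

(* Defs.v *)
From mathcomp Require Import all_boot all_order all_algebra.
From mathcomp Require Import reals complex.

Set Implicit Arguments.
Unset Strict Implicit.
Unset Printing Implicit Defensive.

Import Order.TTheory GRing.Theory Num.Theory.
Local Open Scope ring_scope.
Local Open Scope complex_scope.

Definition complexmx (R : realType) (n : nat) (A : 'M[R]_n) : 'M[R[i]]_n :=
  map_mx (real_complex R) A.

(* [eigenvalue] is defined with row eigenvectors; for a square matrix it has
   the same eigenvalues as the definition with column eigenvectors. *)
Definition isotropicmx (R : realType) (n : nat) (A : 'M[R]_n) : Prop :=
  diagonalizable (complexmx A) /\
  forall z w : R[i], eigenvalue (complexmx A) z -> eigenvalue (complexmx A) w ->
    `|z| = `|w|.

Definition orthogonalmx (R : realType) (n : nat) (U : 'M[R]_n) : Prop :=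
  U^T *m U = 1%:M.

Definition sym_posdefmx (R : realType) (n : nat) (Q : 'M[R]_n) : Prop :=
  Q^T = Q /\ forall x : 'cV[R]_n, x != 0 -> 0 < (x^T *m Q *m x) 0 0.

(* Main.v *)
Require Import Defs.
From mathcomp Require Import all_boot all_order all_algebra.
From mathcomp Require Import reals complex.

(** [A = Q U Q^-1] is the isometry [U] seen in the coordinates given by [Q],
    so it preserves the dot product transported by [Q], whose matrix is
    [Q ^- 2] (and [Q ^+ 2] on the dual space).  In matrix terms, the factors
    [Q^-1] in [A Q ^+ 2 A^T] cancel against [Q ^+ 2], and what is left
    is [Q (U U^T) Q = Q ^+ 2].  The other three identities are formal
    consequences of this single one, for an invertible matrix [S] in place of
    [Q ^+ 2]: the relation [A S A^T = S] passes from [A] to its inverse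
    ([congr_fix_inv]) and from [S] to the inverse form, with [A^T] in place of
    [A] ([congr_fix_dual]).  Both inverses exist since a definite matrix has
    trivial kernel ([sym_posdefmx_unit]). *)

Set Implicit Arguments.
Unset Strict Implicit.
Unset Printing Implicit Defensive.

Import Order.TTheory GRing.Theory Num.Theory.
Local Open Scope ring_scope.
Local Open Scope complex_scope.

(** The form [Q] would vanish at a nonzero vector of the kernel, against
    definiteness. *)
Lemma sym_posdefmx_unit (R : realType) (n : nat) (Q : 'M[R]_n) :
  sym_posdefmx Q -> Q \in unitmx.
Proof.
case=> _ posQ; rewrite unitmxE unitfE; apply/negP => /det0P [v nz_v vQ0].
have := posQ v^T; rewrite trmxK vQ0 mul0mx mxE ltxx => /(_ _) contra.
by apply: notF; apply: contra; rewrite trmx_eq0.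
Qed.

(** Congruence is a group action, so the stabilizer of [S] is a group. *)
Lemma congr_fix_inv (R : comUnitRingType) (n : nat) (A S : 'M[R]_n) :
  A \in unitmx -> A *m S *m A^T = S -> invmx A *m S *m invmx A^T = S.
Proof.
move=> uA fixS; rewrite -{1}fixS -!mulmxA mulmxV ?unitmx_tr // mulmx1.
by rewrite mulKmx.
Qed.

(** Rewritten as [(S^-1 A S) A^T = 1], the relation exhibits an inverse of
    [A^T]; a one-sided inverse being two-sided, the factors may be swapped. *)
Lemma congr_fix_dual (R : comUnitRingType) (n : nat) (A S : 'M[R]_n) :
  S \in unitmx -> A *m S *m A^T = S -> A^T *m invmx S *m A = invmx S.
Proof.
move=> uS fixS.
have : (invmx S *m A *m S) *m A^T = 1%:M.
  by rewrite -!mulmxA (mulmxA A) fixS mulVmx.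
by move/mulmx1C; rewrite !mulmxA => /(canRL (mulmxK uS)); rewrite mul1mx.
Qed.

Theorem corollary4p1 (R : realType) (n : nat) (A U Q : 'M[R]_n)
    (isoA : isotropicmx A)
    (eigA : forall z : R[i], eigenvalue (complexmx A) z -> `|z| = 1)
    (orthU : orthogonalmx U) (posQ : sym_posdefmx Q)
    (defA : A = Q *m U *m invmx Q) :
  (A^T *m invmx (Q ^+ 2) *m A = invmx A^T *m invmx (Q ^+ 2) *m invmx A /\
   invmx A^T *m invmx (Q ^+ 2) *m invmx A = invmx (Q ^+ 2)) /\
  (A *m Q ^+ 2 *m A^T = invmx A *m Q ^+ 2 *m invmx A^T /\
   invmx A *m Q ^+ 2 *m invmx A^T = Q ^+ 2).
Proof.
have uQ := sym_posdefmx_unit posQ; have [symQ _] := posQ.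
have uU : U \in unitmx by case/mulmx1_unit: orthU.
have uA : A \in unitmx by rewrite defA !unitmx_mul uQ uU unitmx_inv uQ.
have uQ2 : Q ^+ 2 \in unitmx by rewrite expr2 unitmx_mul uQ.
have fixQ2 : A *m Q ^+ 2 *m A^T = Q ^+ 2.
  rewrite defA !trmx_mul trmx_inv symQ expr2 -[Q * Q]/(Q *m Q).
  by rewrite -!mulmxA mulKmx // (mulKVmx uQ) (mulmxA U) (mulmx1C orthU) mul1mx.
have fixQ2V := congr_fix_dual uQ2 fixQ2.
have fixVQ2 := congr_fix_inv uA fixQ2.
have fixVQ2V : invmx A^T *m invmx (Q ^+ 2) *m invmx A = invmx (Q ^+ 2).
  have := @congr_fix_inv _ _ A^T (invmx (Q ^+ 2)).
  by rewrite trmxK unitmx_tr; apply.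
by rewrite fixQ2V fixVQ2V fixQ2 fixVQ2.
Qed.
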